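(* $$\frac{91\sqrt{3}}{16} = \sum_{k=0}^{\infty}\left(\frac14\right)^{k}\frac{\left(\frac12\right)_k\left(\frac43\right)_k\left(\frac53\right)_k}{(1)_k\left(\frac{19}{12}\right)_k\left(\frac{25}{12}\right)_k}\,(9k+8).$$
   Context: For $k\in\mathbb{N}_0$, $(\alpha)_k=\alpha(\alpha+1)\cdots(\alpha+k-1)$ is the rising factorial (Pochhammer symbol), with $(\alpha)_0=1$. *)

(* Defs.v *)
From Stdlib Require Import Reals.
From Coquelicot Require Import Coquelicot.
Open Scope R_scope.

(* The rising factorial a (a + 1) ... (a + k - 1), with value 1 at k = 0. *)
Fixpoint rising (a : R) (k : nat) : R :=
  match k with
  | O => 1
  | S j => rising a j * (a + INR j)
  end.

(* Main.v *)
Require Import Defs.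
From Stdlib Require Import Reals Lra Lia.
From Coquelicot Require Import Coquelicot.
Open Scope R_scope.

(** The summand is [91/10 * F(0,k)] for a WZ pair [F(m,k) - F(m+1,k) = G(m,k) - G(m,k+1)]
    with [G(m,0) = 0], so the sum over [k] of [F(m,k)] does not depend on [m].  As [m] grows,
    only the term [k = 0] survives, and [F(m,0)] tends to [5 sqrt 3 / 8]: it is
    asymptotically [5/8] times [w (3 m) / w m] with [w n = (1)_n / (1/2)_n], and
    [w n ^ 2 / (2 n + 1)] has a positive limit.

    The pair comes from the contiguity relations, in the lower parameters [c] and [d], of the
    sum over [n] of [(1/2)_n (1/6)_n / ((c)_n (d)_n)], at [c = 1 + k] and [d = 11/6 + k + m];
    at [c = 1] this sum is Gauss's 2F1 at argument 1. *)

(** * Rising factorials *)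

Lemma rising_S (a : R) (n : nat) : rising a (S n) = rising a n * (a + INR n).
Proof. reflexivity. Qed.

Lemma rising_pos (a : R) (n : nat) : 0 < a -> 0 < rising a n.
Proof.
  intros Ha; induction n as [|n IH]; simpl; [lra|].
  apply Rmult_lt_0_compat; [exact IH|]. pose proof (pos_INR n); lra.
Qed.

Lemma rising_shift (a : R) (n : nat) :
  a * rising (a + 1) n = rising a n * (a + INR n).
Proof.
  induction n as [|n IH]; [simpl; ring|].
  rewrite !rising_S, <- Rmult_assoc, IH, S_INR; ring.
Qed.

(** * Wallis quotients and the limit [sqrt 3] *)

Definition wallis (n : nat) : R := rising 1 n / rising (1 / 2) n.

Lemma wallis_S (n : nat) :
  wallis (S n) = wallis n * ((1 + INR n) / (1 / 2 + INR n)).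
Proof.
  unfold wallis; rewrite !rising_S.
  pose proof (rising_pos (1 / 2) n ltac:(lra)); pose proof (pos_INR n).
  field; lra.
Qed.

Lemma wallis_pos (n : nat) : 0 < wallis n.
Proof. apply Rdiv_lt_0_compat; apply rising_pos; lra. Qed.

(** The partial products of Wallis's product for pi/2: the factor from [n] to [n + 1] is (2n+2)^2 /
    ((2n+1)(2n+3)). *)
Definition wallis_sq (n : nat) : R := wallis n ^ 2 / (2 * INR n + 1).

Lemma wallis_sq_incr (n : nat) : wallis_sq n <= wallis_sq (S n).
Proof.
  unfold wallis_sq; rewrite wallis_S, S_INR.
  pose proof (wallis_pos n); pose proof (pos_INR n).
  set (w := wallis n) in *; set (x := INR n) in *.
  apply Rminus_le_0.
  replace (_ - _) with
    (w ^ 2 * / ((2 * x + 1) * (2 * (x + 1) + 1) * (1 + 2 * x))) by (field; lra).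
  apply Rmult_le_pos; [nra|].
  apply Rlt_le, Rinv_0_lt_compat; nra.
Qed.

Lemma wallis_sq_le (n : nat) : wallis_sq n <= 2.
Proof.
  (* The constant bound on an increasing sequence is not inductive, but this linear one is: the two
     cubics compared in the step differ by exactly 1/4. *)
  assert (H : wallis n ^ 2 <= 4 * INR n + 1).
  { induction n as [|n IH]; [unfold wallis; simpl; lra|].
    rewrite wallis_S, S_INR; pose proof (pos_INR n).
    set (w := wallis n) in *; set (x := INR n) in *.
    replace ((w * ((1 + x) / (1 / 2 + x))) ^ 2)
      with (w ^ 2 * (1 + x) ^ 2 / (1 / 2 + x) ^ 2) by (field; lra).
    apply Rle_div_l; [nra|].
    apply Rle_trans with ((4 * x + 1) * (1 + x) ^ 2); [|nra].
    apply Rmult_le_compat_r; [nra|exact IH]. }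
  unfold wallis_sq; pose proof (pos_INR n).
  apply Rle_div_l; lra.
Qed.

Lemma wallis_sq_lim : exists l : R, 0 < l /\ is_lim_seq wallis_sq l.
Proof.
  destruct (ex_finite_lim_seq_incr wallis_sq 2 wallis_sq_incr wallis_sq_le) as [l Hl].
  exists l; split; [|exact Hl].
  pose proof (is_lim_seq_incr_compare _ _ Hl wallis_sq_incr 0%nat) as H.
  unfold wallis_sq, wallis in H; simpl in H; lra.
Qed.

Lemma is_lim_seq_shift_ratio (a b : R) :
  0 < b -> is_lim_seq (fun n => (INR n + a) / (INR n + b)) 1.
Proof.
  intros Hb.
  apply is_lim_seq_ext with (fun n => 1 + (a - b) * / (INR n + b)).
  { intros n; pose proof (pos_INR n); field; lra. }
  replace (Finite 1) with (Finite (1 + (a - b) * 0)) by (f_equal; ring).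
  apply is_lim_seq_plus'; [apply is_lim_seq_const|].
  apply (is_lim_seq_scal_l _ (a - b) 0).
  apply (is_lim_seq_inv _ p_infty); [|discriminate].
  apply (is_lim_seq_plus _ _ p_infty b);
    [apply is_lim_seq_INR|apply is_lim_seq_const|reflexivity].
Qed.

(* The triplication formulas for [rising 1 (3 n)] and [rising (1/2) (3 n)]. *)
Lemma wallis_triple (n : nat) :
  wallis (3 * n) / wallis n =
  rising (1 / 3) n * rising (2 / 3) n / (rising (1 / 6) n * rising (5 / 6) n).
Proof.
  induction n as [|n IH]; [unfold wallis; simpl; field|].
  replace (3 * S n)%nat with (S (S (S (3 * n)))) by lia.
  rewrite !wallis_S, !rising_S, !S_INR, mult_INR; simpl (INR 3).
  pose proof (wallis_pos n); pose proof (pos_INR n).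
  pose proof (rising_pos (1 / 6) n ltac:(lra)).
  pose proof (rising_pos (5 / 6) n ltac:(lra)).
  replace (rising (1 / 3) n * (1 / 3 + INR n) * (rising (2 / 3) n * (2 / 3 + INR n)) /
    (rising (1 / 6) n * (1 / 6 + INR n) * (rising (5 / 6) n * (5 / 6 + INR n))))
    with (wallis (3 * n) / wallis n *
      ((1 / 3 + INR n) * (2 / 3 + INR n) / ((1 / 6 + INR n) * (5 / 6 + INR n))))
    by (rewrite IH; field; lra).
  field; lra.
Qed.

(** The squared quotient is [wallis_sq (3 * n) / wallis_sq n] times (6n+1)/(2n+1). The first factor
    tends to 1, since a subsequence has the same positive limit; the second tends to 3. *)
Lemma wallis_triple_lim : is_lim_seq (fun n => wallis (3 * n) / wallis n) (sqrt 3).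
Proof.
  destruct wallis_sq_lim as [l [Hl Hlim]].
  apply is_lim_seq_ext with
    (fun n => sqrt (wallis_sq (3 * n) / wallis_sq n *
                    (3 * ((INR n + 1 / 6) / (INR n + 1 / 2))))).
  { intros n; apply sqrt_lem_1.
    - pose proof (pos_INR n).
      assert (0 < wallis_sq n /\ 0 < wallis_sq (3 * n)) as [? ?].
      { split; apply Rdiv_lt_0_compat;
          try (apply pow_lt, wallis_pos);
          [pose proof (pos_INR n)|pose proof (pos_INR (3 * n))]; lra. }
      apply Rmult_le_pos; [apply Rlt_le, Rdiv_lt_0_compat; lra|].
      apply Rmult_le_pos; [lra|apply Rlt_le, Rdiv_lt_0_compat; lra].
    - apply Rlt_le, Rdiv_lt_0_compat; apply wallis_pos.
    - unfold wallis_sq; rewrite mult_INR; simpl (INR 3).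
      pose proof (pos_INR n); pose proof (wallis_pos n); field; lra. }
  apply is_lim_seq_continuous; [apply continuity_pt_sqrt; lra|].
  replace (Finite 3) with (Finite (l / l * (3 * 1))) by (f_equal; field; lra).
  apply is_lim_seq_mult'.
  - apply is_lim_seq_div'; [|exact Hlim|lra].
    apply (is_lim_seq_subseq wallis_sq l (fun n => (3 * n)%nat)); [|exact Hlim].
    apply eventually_subseq; intros n; lia.
  - apply (is_lim_seq_scal_l _ 3 1), is_lim_seq_shift_ratio; lra.
Qed.

(** * The WZ pair *)

Definition wz_base (m k : nat) : R :=
  rising (1 / 2) k * rising (5 / 6) k * rising (4 / 3) (m + k) * rising (5 / 3) (m + k) /
  (rising 1 k * rising (11 / 6) (m + k) * rising (7 / 6) (m + k + k)).

Definition wz_F (m k : nat) : R :=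
  wz_base m k *
  ((INR k * (13 / 6 + 2 * INR k + INR m) +
    (4 / 3 + INR k + INR m) * (5 / 3 + INR k + INR m)) /
   ((7 / 6 + 2 * INR k + INR m) * (13 / 6 + 2 * INR k + INR m))).

Definition wz_G (m k : nat) : R :=
  wz_base m k * (INR k / (7 / 6 + 2 * INR k + INR m)).

Lemma wz_base_pos (m k : nat) : 0 < wz_base m k.
Proof.
  apply Rdiv_lt_0_compat; repeat apply Rmult_lt_0_compat; apply rising_pos; lra.
Qed.

Ltac rising_nonzero :=
  repeat split; try lra;
  apply Rgt_not_eq, rising_pos; lra.

Lemma wz_base_S_r (m k : nat) :
  wz_base m (S k) =
  wz_base m k *
  ((1 / 2 + INR k) * (5 / 6 + INR k) *
   (4 / 3 + INR k + INR m) * (5 / 3 + INR k + INR m) /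
   ((1 + INR k) * (11 / 6 + INR k + INR m) *
    (7 / 6 + 2 * INR k + INR m) * (13 / 6 + 2 * INR k + INR m))).
Proof.
  unfold wz_base.
  replace (m + S k + S k)%nat with (S (S (m + k + k))) by lia.
  replace (m + S k)%nat with (S (m + k)) by lia.
  rewrite !rising_S, !S_INR, !plus_INR.
  pose proof (pos_INR m); pose proof (pos_INR k).
  field; rising_nonzero.
Qed.

Lemma wz_base_S_l (m k : nat) :
  wz_base (S m) k =
  wz_base m k *
  ((4 / 3 + INR k + INR m) * (5 / 3 + INR k + INR m) /
   ((11 / 6 + INR k + INR m) * (7 / 6 + 2 * INR k + INR m))).
Proof.
  unfold wz_base; simpl (S m + k)%nat; simpl (S (m + k) + k)%nat.
  rewrite !rising_S, !plus_INR.
  pose proof (pos_INR m); pose proof (pos_INR k).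
  field; rising_nonzero.
Qed.

(** All four terms are rational multiples of [wz_base m k], so this is an identity of rational
    functions in [k] and [m]. *)
Lemma wz_pair (m k : nat) :
  wz_F m k - wz_F (S m) k = wz_G m k - wz_G m (S k).
Proof.
  unfold wz_F, wz_G; rewrite wz_base_S_l, wz_base_S_r, !S_INR.
  pose proof (pos_INR m); pose proof (pos_INR k).
  field; lra.
Qed.

(** * Limit in [m] and decay in [k] *)

Lemma wz_base_0_lim : is_lim_seq (fun m => wz_base m 0) (5 * sqrt 3 / 8).
Proof.
  apply is_lim_seq_ext with
    (fun m => 5 / 8 * (wallis (3 * m) / wallis m *
      ((INR m + 1 / 3) / (INR m + 1 / 6) * ((INR m + 2 / 3) / (INR m + 5 / 6))))).
  { intros m; rewrite wallis_triple; unfold wz_base.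
    rewrite !Nat.add_0_r; simpl (rising _ 0).
    (* Lowering the four parameters by 1 gives those of [wallis_triple]; the constants combine to 3
       (3/2) / ((6/5) 6) = 5/8. *)
    pose proof (rising_shift (1 / 3) m) as H1; pose proof (rising_shift (2 / 3) m) as H2.
    pose proof (rising_shift (5 / 6) m) as H3; pose proof (rising_shift (1 / 6) m) as H4.
    replace (1 / 3 + 1) with (4 / 3) in H1 by field.
    replace (2 / 3 + 1) with (5 / 3) in H2 by field.
    replace (5 / 6 + 1) with (11 / 6) in H3 by field.
    replace (1 / 6 + 1) with (7 / 6) in H4 by field.
    replace (rising (4 / 3) m) with (rising (1 / 3) m * (1 / 3 + INR m) * 3) by lra.
    replace (rising (5 / 3) m) with (rising (2 / 3) m * (2 / 3 + INR m) * (3 / 2)) by lra.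
    replace (rising (11 / 6) m) with (rising (5 / 6) m * (5 / 6 + INR m) * (6 / 5)) by lra.
    replace (rising (7 / 6) m) with (rising (1 / 6) m * (1 / 6 + INR m) * 6) by lra.
    pose proof (pos_INR m).
    field; rising_nonzero. }
  replace (Finite (5 * sqrt 3 / 8)) with (Finite (5 / 8 * (sqrt 3 * (1 * 1))))
    by (f_equal; field).
  apply (is_lim_seq_scal_l _ (5 / 8) (sqrt 3 * (1 * 1))).
  apply is_lim_seq_mult'; [exact wallis_triple_lim|].
  apply is_lim_seq_mult'; apply is_lim_seq_shift_ratio; lra.
Qed.

(** The sequence increases to its limit: as 4/3 + 5/3 = 11/6 + 7/6, the ratio of successive terms is
    at least 1 because 20/9 > 77/36. *)
Lemma wz_base_0_le (m : nat) : wz_base m 0 <= 5 * sqrt 3 / 8.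
Proof.
  revert m; apply is_lim_seq_incr_compare; [exact wz_base_0_lim|].
  intros m; rewrite wz_base_S_l; simpl (INR 0).
  pose proof (wz_base_pos m 0); pose proof (pos_INR m).
  rewrite <- (Rmult_1_r (wz_base m 0)) at 1.
  apply Rmult_le_compat_l; [lra|].
  apply Rle_div_r; nra.
Qed.

Lemma wz_base_half (m k : nat) : wz_base m (S k) <= wz_base m k * (1 / 2).
Proof.
  rewrite wz_base_S_r.
  pose proof (wz_base_pos m k); pose proof (pos_INR m); pose proof (pos_INR k).
  apply Rmult_le_compat_l; [lra|].
  set (x := INR k) in *; set (y := INR m) in *.
  (* Three of the quotients are at most 1, and what is left, (1/2 + x) / (7/6 + 2x + y), is at most
     1/2. *)
  replace (_ / _) with
    ((1 / 2 + x) * ((5 / 6 + x) / (1 + x)) *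
     ((4 / 3 + x + y) / (11 / 6 + x + y)) * ((5 / 3 + x + y) / (13 / 6 + 2 * x + y)) /
     (7 / 6 + 2 * x + y)) by (field; lra).
  assert (forall p q, 0 < p -> p <= q -> 0 <= p / q <= 1) as Hle.
  { intros p q Hp Hq; split; [apply Rlt_le, Rdiv_lt_0_compat; lra|].
    apply Rle_div_l; lra. }
  pose proof (Hle (5 / 6 + x) (1 + x) ltac:(lra) ltac:(lra)) as [a0 a1].
  pose proof (Hle (4 / 3 + x + y) (11 / 6 + x + y) ltac:(lra) ltac:(lra)) as [b0 b1].
  pose proof (Hle (5 / 3 + x + y) (13 / 6 + 2 * x + y) ltac:(lra) ltac:(lra)) as [c0 c1].
  set (a := (5 / 6 + x) / (1 + x)) in *.
  set (b := (4 / 3 + x + y) / (11 / 6 + x + y)) in *.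
  set (c := (5 / 3 + x + y) / (13 / 6 + 2 * x + y)) in *.
  apply Rle_div_l; [lra|].
  assert (a * b * c <= 1).
  { assert (0 <= a * b <= 1) by nra. nra. }
  replace ((1 / 2 + x) * a * b * c) with ((1 / 2 + x) * (a * b * c)) by ring.
  nra.
Qed.

Lemma wz_base_geom (m k : nat) : wz_base m k <= wz_base m 0 * (1 / 2) ^ k.
Proof.
  induction k as [|k IH]; [simpl; lra|].
  pose proof (wz_base_half m k); simpl; lra.
Qed.

(** The extra decay in [m] that makes all terms beyond [k = 0] vanish in the limit. *)
Lemma wz_base_1_le (m : nat) : wz_base m 1 <= wz_base m 0 / (INR m + 1).
Proof.
  rewrite wz_base_S_r; simpl (INR 0).
  pose proof (wz_base_pos m 0); pose proof (pos_INR m).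
  set (y := INR m) in *.
  replace (wz_base m 0 / (y + 1)) with (wz_base m 0 * (1 / (y + 1))) by (field; lra).
  apply Rmult_le_compat_l; [lra|].
  apply (Rle_div_r _ 1 (y + 1)); [lra|].
  match goal with |- ?a / ?b * ?c <= 1 =>
    replace (a / b * c) with (a * c / b) by (field; lra) end.
  apply Rle_div_l; [repeat apply Rmult_lt_0_compat; lra|].
  assert (0 <= y * y) by nra; assert (0 <= y * (y * y)) by nra; lra.
Qed.

Lemma wz_F_bounds (m k : nat) : 0 <= wz_F m k <= 2 * wz_base m k.
Proof.
  unfold wz_F.
  pose proof (wz_base_pos m k); pose proof (pos_INR m); pose proof (pos_INR k).
  set (x := INR k) in *; set (y := INR m) in *.
  split.
  - apply Rmult_le_pos; [lra|].
    apply Rlt_le, Rdiv_lt_0_compat; nra.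
  - rewrite (Rmult_comm 2 (wz_base m k)); apply Rmult_le_compat_l; [lra|].
    apply Rle_div_l; nra.
Qed.

Lemma wz_G_bounds (m k : nat) :
  0 <= wz_G m k <= 5 * sqrt 3 / 8 * (1 / 2) ^ k.
Proof.
  unfold wz_G.
  pose proof (wz_base_pos m k); pose proof (pos_INR m); pose proof (pos_INR k).
  assert (0 <= INR k / (7 / 6 + 2 * INR k + INR m) <= 1) as [? ?].
  { split; [apply Rle_div_r|apply Rle_div_l]; lra. }
  pose proof (wz_base_geom m k); pose proof (wz_base_0_le m).
  pose proof (pow_lt (1 / 2) k ltac:(lra)).
  split; [apply Rmult_le_pos; lra|].
  apply Rle_trans with (wz_base m k); [nra|].
  apply Rle_trans with (wz_base m 0 * (1 / 2) ^ k); nra.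
Qed.

(** * Comparing rows and summing the series *)

Lemma wz_sum_S (m n : nat) :
  sum_n (wz_F (S m)) n = sum_n (wz_F m) n + wz_G m (S n).
Proof.
  induction n as [|n IH].
  - rewrite !sum_O. pose proof (wz_pair m 0) as H.
    assert (wz_G m 0 = 0) by (unfold wz_G; simpl (INR 0); unfold Rdiv; ring). lra.
  - rewrite !sum_Sn, IH; pose proof (wz_pair m (S n)); unfold plus; simpl. lra.
Qed.

(** Going from row 0 to row [m] adds [m] nonnegative boundary terms of [wz_G], bounded uniformly in
    the row. *)
Lemma wz_sum_bounds (m n : nat) :
  sum_n (wz_F 0) n <= sum_n (wz_F m) n <=
  sum_n (wz_F 0) n + INR m * (5 * sqrt 3 / 8 * (1 / 2) ^ S n).
Proof.
  induction m as [|m IH]; [simpl (INR 0); lra|].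
  rewrite wz_sum_S, S_INR; pose proof (wz_G_bounds m (S n)); lra.
Qed.

Lemma wz_sum_head (m n : nat) :
  wz_F m 0 <= sum_n (wz_F m) n <= wz_F m 0 + 4 * wz_base m 1.
Proof.
  assert (Hgeom : forall k, wz_base m (S k) <= wz_base m 1 * (1 / 2) ^ k).
  { induction k as [|k IH]; [simpl; lra|].
    pose proof (wz_base_half m (S k)); simpl; lra. }
  (* The factor [1 - (1 / 2) ^ n] records the partial geometric sum, so that the induction
     closes. *)
  enough (wz_F m 0 <= sum_n (wz_F m) n <=
          wz_F m 0 + 4 * wz_base m 1 * (1 - (1 / 2) ^ n)).
  { pose proof (pow_lt (1 / 2) n ltac:(lra)); pose proof (wz_base_pos m 1); nra. }
  induction n as [|n IH]; [rewrite sum_O; simpl; lra|].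
  rewrite sum_Sn; unfold plus; simpl.
  pose proof (wz_F_bounds m (S n)); pose proof (Hgeom n); lra.
Qed.

Lemma INR_half_pow_le (n : nat) : INR n * (1 / 2) ^ n <= 2 / (INR n + 1).
Proof.
  assert (H : INR n * (INR n + 1) <= 2 * 2 ^ n).
  { destruct n as [|[|n]]; [simpl; lra..|].
    induction n as [|n IH]; [simpl; lra|].
    rewrite S_INR, <- tech_pow_Rmult.
    rewrite S_INR in IH |- *. rewrite S_INR in IH |- *.
    pose proof (pos_INR n). nra. }
  pose proof (pos_INR n); pose proof (pow_lt 2 n ltac:(lra)).
  apply (Rle_div_r _ 2 (INR n + 1)); [lra|].
  replace (1 / 2) with (/ 2) by lra; rewrite pow_inv.
  replace (INR n * / 2 ^ n * (INR n + 1)) with (INR n * (INR n + 1) / 2 ^ n)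
    by (field; lra).
  apply Rle_div_l; lra.
Qed.

Lemma wz_F_0_lim : is_lim_seq (fun m => wz_F m 0) (5 * sqrt 3 / 8).
Proof.
  apply is_lim_seq_ext with
    (fun m => wz_base m 0 *
      ((INR m + 4 / 3) / (INR m + 7 / 6) * ((INR m + 5 / 3) / (INR m + 13 / 6)))).
  { intros m; unfold wz_F; simpl (INR 0); pose proof (pos_INR m); field; lra. }
  replace (Finite (5 * sqrt 3 / 8)) with (Finite (5 * sqrt 3 / 8 * (1 * 1)))
    by (f_equal; ring).
  apply is_lim_seq_mult'; [exact wz_base_0_lim|].
  apply is_lim_seq_mult'; apply is_lim_seq_shift_ratio; lra.
Qed.

(* Both error terms are O(1/n) along the diagonal [m = n]. *)
Lemma wz_F_series : is_series (wz_F 0) (5 * sqrt 3 / 8).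
Proof.
  change (is_lim_seq (sum_n (wz_F 0)) (5 * sqrt 3 / 8)).
  set (c := 5 * sqrt 3 / 8).
  assert (Hc : 0 < c) by (unfold c; pose proof (sqrt_lt_R0 3 ltac:(lra)); lra).
  assert (Hinv : forall d : R, is_lim_seq (fun n => wz_F n 0 + d * / (INR n + 1)) c).
  { intros d; replace (Finite c) with (Finite (c + d * 0)) by (f_equal; ring).
    apply is_lim_seq_plus'; [exact wz_F_0_lim|].
    apply (is_lim_seq_scal_l _ d 0).
    apply (is_lim_seq_inv _ p_infty); [|discriminate].
    apply (is_lim_seq_plus _ _ p_infty 1);
      [apply is_lim_seq_INR|apply is_lim_seq_const|reflexivity]. }
  (* The error [- c] comes from replacing row [n] by row 0, the error [4 * c] from the terms of row
     [n] beyond [k = 0]. *)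
  apply is_lim_seq_le_le with
    (fun n => wz_F n 0 + - c * / (INR n + 1)) (fun n => wz_F n 0 + (4 * c) * / (INR n + 1));
    [|apply Hinv|apply Hinv].
  intros n.
  pose proof (wz_sum_bounds n n) as [Hs1 Hs2]; pose proof (wz_sum_head n n) as [Hh1 Hh2].
  pose proof (pos_INR n); pose proof (wz_base_1_le n) as Hb.
  pose proof (wz_base_0_le n) as H0; fold c in H0, Hs2.
  assert (Hi : 0 < / (INR n + 1)) by (apply Rinv_0_lt_compat; lra).
  split.
  - pose proof (INR_half_pow_le n) as Hp; simpl (_ ^ S n) in Hs2; unfold Rdiv in Hp.
    assert (INR n * (c * (1 * / 2 * (1 * / 2) ^ n)) <= c * / (INR n + 1)).
    { replace (INR n * (c * (1 * / 2 * (1 * / 2) ^ n)))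
        with (c * (/ 2 * (INR n * (1 * / 2) ^ n))) by ring.
      apply Rmult_le_compat_l; lra. }
    unfold Rdiv in Hs2; lra.
  - unfold Rdiv in Hb; nra.
Qed.

(** * Row 0 as the stated summand *)

(** The duplication formula for (7/6)_(2k+2), with 91/36 = 4 (7/12) (13/12) split off. *)
Lemma rising_double (k : nat) :
  rising (7 / 6) (k + k) * ((7 / 6 + 2 * INR k) * (13 / 6 + 2 * INR k)) =
  91 / 36 * (4 ^ k * (rising (19 / 12) k * rising (25 / 12) k)).
Proof.
  induction k as [|k IH]; [simpl; field|].
  replace (S k + S k)%nat with (S (S (k + k))) by lia.
  rewrite !rising_S, <- tech_pow_Rmult, !S_INR, plus_INR.
  transitivity (rising (7 / 6) (k + k) * ((7 / 6 + 2 * INR k) * (13 / 6 + 2 * INR k)) *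
    ((19 / 6 + 2 * INR k) * (25 / 6 + 2 * INR k))); [field|].
  rewrite IH; field.
Qed.

(** At [m = 0] the numerator in [wz_F] factors as (k + 5/6)(9k + 8)/3, and k + 5/6 cancels against
    (5/6)_k / (11/6)_k. *)
Lemma wz_F_0_l (k : nat) :
  91 / 10 * wz_F 0 k =
  (1 / 4) ^ k *
  ((rising (1 / 2) k * rising (4 / 3) k * rising (5 / 3) k) /
   (rising 1 k * rising (19 / 12) k * rising (25 / 12) k)) *
  (9 * INR k + 8).
Proof.
  unfold wz_F, wz_base; simpl (0 + k)%nat; simpl (INR 0).
  pose proof (rising_double k) as Hd; pose proof (rising_shift (5 / 6) k) as Hs.
  replace (5 / 6 + 1) with (11 / 6) in Hs by field.
  replace (rising (11 / 6) k) with (rising (5 / 6) k * (5 / 6 + INR k) * (6 / 5)) by lra.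
  pose proof (pos_INR k).
  replace (rising (7 / 6) (k + k)) with
    (91 / 36 * (4 ^ k * (rising (19 / 12) k * rising (25 / 12) k)) /
     ((7 / 6 + 2 * INR k) * (13 / 6 + 2 * INR k))) by (rewrite <- Hd; field; lra).
  replace (1 / 4) with (/ 4) by lra; rewrite pow_inv.
  pose proof (pow_lt 4 k ltac:(lra)).
  field; rising_nonzero.
Qed.

Theorem mainTheorem7 :
  is_series
    (fun k : nat =>
       (1 / 4) ^ k *
       ((rising (1 / 2) k * rising (4 / 3) k * rising (5 / 3) k) /
        (rising 1 k * rising (19 / 12) k * rising (25 / 12) k)) *
       (9 * INR k + 8))
    (91 * sqrt 3 / 16).
Proof.
  replace (91 * sqrt 3 / 16) with (91 / 10 * (5 * sqrt 3 / 8)) by field.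
  apply is_series_ext with (fun k => scal (91 / 10) (wz_F 0 k)).
  - exact wz_F_0_l.
  - exact (is_series_scal (91 / 10) _ _ wz_F_series).
Qed.
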